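(* There are infinitely many real numbers $r$ for which there exists a positive integer $n$ with $f_r(n)=f_r(n+1)$ (equivalently, for which $\#\mathcal{R}^r_{(1,-1)}(x)>0$ for some $x$, where $\#\mathcal{R}^r_{(1,-1)}(x)$ is the number of positive integers $n\le x$ with $f_r(n)=f_r(n+1)$).
   Context: For a positive integer $n=\prod_{i=1}^k p_i^{a_i}$ (distinct primes $p_i$) and real $r$, $f_r(n)=\sum_{i=1}^k a_i p_i^r$, with $f_r(1)=0$. *)

(* Defs.v *)
From HB Require Import structures.
From mathcomp Require Import all_boot all_order all_algebra finmap.
From mathcomp Require Import all_classical all_reals all_analysis.
Set Implicit Arguments.
Unset Strict Implicit.
Unset Printing Implicit Defensive.
Import Order.TTheory GRing.Theory Num.Theory.
Local Open Scope classical_set_scope.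
Local Open Scope ring_scope.

(* The exponent a_i of p_i in n is [logn p n]; [p%:R `^ r] is the real power,
   since p > 0.  [primes 1] is empty, so [f r 1 = 0]. *)
Definition f (R : realType) (r : R) (n : nat) : R :=
  \sum_(p <- primes n) (logn p n)%:R * (p%:R `^ r).

Definition ruth_aaron (R : realType) (r x : R) : set nat :=
  [set n : nat | (0 < n)%N /\ n%:R <= x /\ f r n = f r n.+1].

(* [fset_set] returns the empty set on infinite sets; [ruth_aaron r x] is always
   finite, being bounded by x, so this is its true cardinality. *)
Definition num_ruth_aaron (R : realType) (r x : R) : nat :=
  #|` fset_set (ruth_aaron r x)|%fset.

(* Main.v *)
Require Import Defs.
From HB Require Import structures.
From mathcomp Require Import all_boot all_order all_algebra finmap.
From mathcomp Require Import all_classical all_reals all_analysis.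
From mathcomp Require Import lra zify.
Set Implicit Arguments.
Unset Strict Implicit.
Unset Printing Implicit Defensive.
Import Order.TTheory GRing.Theory Num.Theory.
Import numFieldNormedType.Exports.
Local Open Scope classical_set_scope.
Local Open Scope ring_scope.

(* For r > 0 there is C with f_r(n) <= n^r + C: split off the least prime factor
   q of a composite n = q t, and use q^r + t^r <= (q t)^r, which holds once t is
   large.  Hence f_r(2m) = 2^r + f_r(m) < (2m+1)^r for all large m.  Take a large
   prime p = 2m+1.  At exponent 0, f_0(p) = 1 < f_0(2m), while at any prescribed
   e > 0 the inequality is reversed, so by the intermediate value theorem
   f_r(2m) = f_r(p) for some r in ]0, e].  Thus solutions r > 0 accumulate at 0. *)

(** Extra indices contribute nothing, as [logn] vanishes there. This lets the sums for [m], [n] and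
    [m * n] run over one common list. *)
Lemma f_uniqE (R : realType) (r : R) (n : nat) (s : seq nat) :
  uniq s -> {subset primes n <= s} ->
  f r n = \sum_(p <- s) (logn p n)%:R * (p%:R `^ r).
Proof.
move=> us sub.
rewrite [RHS](bigID (mem (primes n))) /= [X in _ + X]big1 ?addr0; last first.
  by move=> p; rewrite -logn_gt0 lt0n negbK => /eqP->; rewrite mul0r.
rewrite -big_filter; apply: perm_big; apply: uniq_perm.
- exact: primes_uniq.
- exact: filter_uniq.
by move=> p; rewrite mem_filter andb_idr// => /sub.
Qed.

Lemma fM (R : realType) (r : R) (m n : nat) : (0 < m)%N -> (0 < n)%N ->
  f r (m * n) = f r m + f r n.
Proof.
move=> m0 n0.
have sub k : (0 < k)%N -> (k %| m * n)%N -> {subset primes k <= primes (m * n)}.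
  move=> k0 kmn p; rewrite !mem_primes muln_gt0 m0 n0 k0/= => /andP[-> pk].
  exact: dvdn_trans pk kmn.
rewrite (f_uniqE r (primes_uniq (m * n)) (sub m m0 (dvdn_mulr _ (dvdnn m)))).
rewrite (f_uniqE r (primes_uniq (m * n)) (sub n n0 (dvdn_mull _ (dvdnn n)))).
rewrite -big_split; apply: eq_bigr => p _.
by rewrite lognM// natrD mulrDl.
Qed.

Lemma f_prime (R : realType) (r : R) (p : nat) : prime p -> f r p = p%:R `^ r.
Proof.
by move=> pp; rewrite /f primes_prime// big_seq1 logn_prime// eqxx mul1r.
Qed.

Lemma f_ge0 (R : realType) (r : R) (n : nat) : 0 <= f r n.
Proof. by apply: sumr_ge0 => p _; rewrite mulr_ge0// powR_ge0. Qed.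

(** At exponent 0, [f] counts prime factors with multiplicity; one of them is split off. *)
Lemma f0_ge1 (R : realType) (n : nat) : (1 < n)%N -> 1 <= f (0 : R) n.
Proof.
move=> n1; have pp := pdiv_prime n1.
have /dvdnP[t nE] := pdiv_dvd n.
have t0 : (0 < t)%N by case: t nE => // nE; rewrite nE in n1.
by rewrite nE fM ?(prime_gt0 pp)// (f_prime _ pp) powRr0 lerDr f_ge0.
Qed.

Lemma continuous_f (R : realType) (n : nat) : continuous (fun r : R => f r n).
Proof.
rewrite /f; apply: continuous_big; first exact: add_continuous.
(* Here [p] is arbitrary, and the power of base 0 jumps at exponent 0; its coefficient [logn 0 n] is
   0. *)
move=> p _ r; have [->|p_neq0] := eqVneq p 0%N.
  under eq_fun do rewrite lognE /= mul0r.
  exact: cvg_cst.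
have p0 : p%:R != 0 :> R by rewrite pnatr_eq0.
apply: cvgM; first exact: cvg_cst.
rewrite /powR (negbTE p0).
apply: continuous_comp; last exact: continuous_expR.
by apply: cvgM; [exact: cvg_id | exact: cvg_cst].
Qed.

Lemma powR_nat_unbounded (R : realType) (r A : R) : 0 < r -> 0 <= A ->
  exists T : nat, forall t, (T <= t)%N -> A <= t%:R `^ r.
Proof.
move=> r0 A0; exists (Num.truncn (A `^ r^-1)).+1 => t Tt.
have -> : A = (A `^ r^-1) `^ r by rewrite -powRrM mulVf ?powRr1// gt_eqF.
apply: ge0_ler_powR; rewrite ?nnegrE ?powR_ge0 ?(ltW r0)//.
by apply/ltW; apply: lt_le_trans (truncnS_gt _) _; rewrite ler_nat.
Qed.

Lemma powR_nat_gt1 (R : realType) (r : R) (n : nat) : 0 < r -> (1 < n)%N ->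
  1 < n%:R `^ r :> R.
Proof.
move=> r0 n1; have {1}<- : 1 `^ r = 1 :> R by rewrite powR1.
by apply: gt0_ltr_powR; rewrite ?nnegrE ?ltr1n.
Qed.

Lemma f_le_powR (R : realType) (r : R) : 0 < r ->
  exists2 C : R, 0 <= C & forall n, f r n <= n%:R `^ r + C.
Proof.
move=> r0; set a : R := 2%:R `^ r - 1.
have a0 : 0 < a by rewrite subr_gt0 powR_nat_gt1.
have A0 : 0 <= 1 + a^-1 by rewrite addr_ge0// invr_ge0 ltW.
have [T hT] := powR_nat_unbounded r0 A0.
have C0 : 0 <= \sum_(i < T ^ 2) f r i by apply: sumr_ge0 => i _; exact: f_ge0.
(* All terms are nonnegative, so this constant bounds each [f r n] with n < T^2; the rest is strong
   induction on [n]. *)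
exists (\sum_(i < T ^ 2) f r i) => //.
move=> n; have [m] := ubnP n; elim: m n => // m IH n; rewrite ltnS => nm.
have [nT|Tn] := ltnP n (T ^ 2).
  rewrite (bigD1 (Ordinal nT))//= addrCA lerDl addr_ge0 ?powR_ge0//.
  by apply: sumr_ge0 => i _; exact: f_ge0.
have [pn|npn] := boolP (prime n); first by rewrite f_prime// lerDl.
have [n1|n1] := leqP n 1.
  have -> : f r n = 0 by case: n n1 {IH nm Tn npn} => [|[|]]//; rewrite /f big_nil.
  by rewrite addr_ge0 ?powR_ge0.
have pp := pdiv_prime n1; have q1 := prime_gt1 pp.
have /dvdnP[t nE] := pdiv_dvd n.
(* As [n] is composite, its least prime factor q satisfies q^2 <= n = t q. So q <= t, and T^2 <= n
   <= t^2 gives T <= t. *)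
have qn : (pdiv n ^ 2 <= n)%N.
  by rewrite leqNgt; apply/negP => /(ltn_pdiv2_prime (ltnW n1)); exact/negP.
move: pp q1 nE qn; set q := pdiv n => pp q1 nE qn.
have qt : (q <= t)%N by move: qn; rewrite nE -mulnn leq_pmul2r// prime_gt0.
have Tt : (T <= t)%N.
  by rewrite -(@leq_exp2r _ _ 2)// (leq_trans Tn)// nE -mulnn leq_mul2l qt orbT.
have t0 : (0 < t)%N by apply: leq_trans qt; exact: prime_gt0.
have tm : (t < m)%N by apply: leq_trans nm; rewrite nE ltn_Pmulr.
have := IH _ tm.
rewrite nE fM ?(prime_gt0 pp)// (f_prime _ pp) natrM powRM//.
have := hT _ Tt.
have : 2%:R `^ r <= q%:R `^ r :> R.
  by apply: ge0_ler_powR; rewrite ?nnegrE ?ler_nat ?(ltW r0).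
have : a * a^-1 = 1 by rewrite divff// gt_eqF.
have : 0 < a^-1 by rewrite invr_gt0.
have -> : 2%:R `^ r = a + 1 by rewrite subrK.
move: (a^-1) (q%:R `^ r) (t%:R `^ r) (f r t) (\sum_(i < _) _) => b Q X ft C.
move=> b0 ab Qa Xb ftX.
(* [X + Q <= X * Q] amounts to [1 <= (X - 1) * (Q - 1)]. *)
have : b * a <= (X - 1) * (Q - 1) by apply: ler_pM; lra.
lra.
Qed.

Lemma f_double_lt (R : realType) (r : R) : 0 < r ->
  exists N : nat, forall m, (N <= m)%N -> f r (2 * m) < (2 * m).+1%:R `^ r.
Proof.
move=> r0; have [C C0 hC] := f_le_powR r0; set c : R := 2%:R `^ r.
have c1 : 1 < c by exact: powR_nat_gt1.
(* Once m^r reaches this value, c + m^r + C <= c m^r = (2m)^r. *)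
have A0 : 0 <= (c + C) / (c - 1) by rewrite divr_ge0//; lra.
have [T hT] := powR_nat_unbounded r0 A0.
exists T.+1 => m Tm.
have m0 : (0 < m)%N by exact: leq_trans Tm.
rewrite fM// (f_prime _ (isT : prime 2)) -/c.
apply: (@le_lt_trans _ _ ((2 * m)%:R `^ r)); last first.
  by apply: gt0_ltr_powR; rewrite ?nnegrE ?ltr_nat.
rewrite natrM powRM// -/c.
have := hT _ (ltnW Tm); rewrite ler_pdivrMr ?subr_gt0//.
by have := hC m; lra.
Qed.

Lemma small_root (R : realType) (e : R) : 0 < e ->
  exists2 r : R, 0 < r <= e & exists n : nat, (0 < n)%N /\ f r n = f r n.+1.
Proof.
move=> e0; have [N hN] := f_double_lt e0.
(* The margin makes [p] odd and forces both N <= m, for the sign at [e], and 1 < m, for the sign at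
   0. *)
have [p Np pp] := prime_above (2 * N.+2).
have [m pE] : exists m, p = (2 * m).+1.
  exists p./2; rewrite mul2n -[LHS]odd_double_half.
  by case: (even_prime pp) => [p2|->//]; rewrite p2 in Np; lia.
have Nm : (N.+1 < m)%N by lia.
rewrite pE in pp.
pose h (r : R) := f r (2 * m).+1 - f r (2 * m).
have h0 : h 0 < 0.
  rewrite /h (f_prime _ pp) powRr0 fM ?(f_prime _ (isT : prime 2))//; last lia.
  have : 1 <= f (0 : R) m by apply: f0_ge1; lia.
  by rewrite powRr0; lra.
have he : 0 < h e by rewrite subr_gt0 (f_prime _ pp) hN//; lia.
have ch : {within `[0, e], continuous h}.
  apply: continuous_subspaceT => x.
  by apply: cvgB; exact: continuous_f.
have [|r] := @IVT R h 0 e 0 (ltW e0) ch.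
  by rewrite ge_min le_max (ltW h0) (ltW he) orbT.
rewrite in_itv/= => /andP[r0 re] hr; exists r.
  (* The intermediate value theorem allows r = 0, which [h 0 < 0] excludes. *)
  rewrite re andbT lt_neqAle r0 andbT; apply/eqP => rE.
  by rewrite -rE in hr; move: h0; rewrite hr ltxx.
exists (2 * m)%N; split; first lia.
by apply/esym/eqP; rewrite -subr_eq0; apply/eqP.
Qed.

(** A finite list cannot accumulate at 0 from the right. Halving [y] keeps the bound strict. *)
Lemma seq_pos_lower_bound (R : realType) (s : seq R) :
  exists2 e : R, 0 < e & forall x, x \in s -> 0 < x -> e < x.
Proof.
elim: s => [|y s [e e0 he]]; first by exists 1.
have [y0|y0] := leP y 0.
  by exists e => // x; rewrite inE => /predU1P[->|/he//]; rewrite ltNge y0.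
exists (Num.min e (y / 2)); first by rewrite lt_min e0 divr_gt0.
move=> x; rewrite inE gt_min => /predU1P[-> _|xs x0]; last by rewrite he.
by apply/orP; right; lra.
Qed.

Lemma finite_ruth_aaron (R : realType) (r x : R) : finite_set (ruth_aaron r x).
Proof.
apply: (@sub_finite_set _ _ `I_(Num.truncn x).+1); last exact: finite_II.
move=> n [_ [nx _]] /=; rewrite -(ltr_nat R).
exact: le_lt_trans nx (truncnS_gt x).
Qed.

(** By finiteness [fset_set] does not take its default value, so a positive count yields an actual
    member. *)
Lemma num_ruth_aaron_gt0 (R : realType) (r x : R) :
  (0 < num_ruth_aaron r x)%N <-> exists n, ruth_aaron r x n.
Proof.
rewrite /num_ruth_aaron cardfs_gt0; split.
  case/fset0Pn => n; rewrite in_fset_set; last exact: finite_ruth_aaron.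
  by rewrite inE; exists n.
move=> [n nx]; apply/fset0Pn; exists n.
by rewrite in_fset_set ?inE//; exact: finite_ruth_aaron.
Qed.

Theorem theorem1p3 (R : realType) :
  infinite_set [set r : R | exists n : nat, (0 < n)%N /\ f r n = f r n.+1] /\
  (forall r : R,
     (exists n : nat, (0 < n)%N /\ f r n = f r n.+1) <->
     (exists x : R, (0 < num_ruth_aaron r x)%N)).
Proof.
split.
  move=> /finite_seqP[s sE].
  (* If [s] listed all solutions, the root in ]0, e] would be a positive entry of [s] not above
     [e]. *)
  have [e e0 he] := seq_pos_lower_bound s.
  have [r /andP[r0 re] hr] := small_root e0.
  have rs : r \in s by have : [set` s] r by rewrite -sE.
  by have := he r rs r0; rewrite ltNge re.
move=> r; split=> [[n [n0 hn]]|[x /num_ruth_aaron_gt0[n [n0 [_ hn]]]]].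
  by exists n%:R; apply/num_ruth_aaron_gt0; exists n.
by exists n.
Qed.
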